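(* Let $\mathcal{E}\in\mathcal{T}_{\mathbb{K}}$. Then $\mathcal{E}$ has a unique maximal nilpotent ideal, denoted $\operatorname{Nil}(\mathcal{E})$. In fact, writing (as is always possible up to isomorphism) $\mathcal{E}=\mathcal{E}_k(\lambda_1,\dots,\lambda_n)$ with $k\geq 2$ and $\lambda_1,\dots,\lambda_k\neq 0$, one has $$\operatorname{Nil}\big(\mathcal{E}_k(\lambda_1,\dots,\lambda_n)\big)=\operatorname{span}\{\lambda_2e_1-\lambda_1e_2,\ \lambda_3e_1-\lambda_1e_3,\ \dots,\ \lambda_ke_1-\lambda_1e_k,\ e_{k+1},\dots,e_n\}.$$
   Context: $\mathbb{K}$ is a field of characteristic different from $2$. An evolution algebra over $\mathbb{K}$ is a finite-dimensional $\mathbb{K}$-algebra (commutative, not necessarily associative) having a basis $B=\{e_1,\dots,e_n\}$, called a natural basis, with $e_ie_j=0$ for all $i\neq j$. For an algebra $\mathcal{A}$ put $\mathcal{A}^1=\mathcal{A}$, $\mathcal{A}^{m+1}=\sum_{i=1}^m\mathcal{A}^i\mathcal{A}^{m+1-i}$, and $\mathcal{A}^{(1)}=\mathcal{A}$, $\mathcal{A}^{(m+1)}=\mathcal{A}^{(m)}\mathcal{A}^{(m)}$ (products of subspaces are linear spans of products). $\mathcal{A}$ is nilpotent if $\mathcal{A}^m=0$ for some $m$, and solvable if $\mathcal{A}^{(m)}=0$ for some $m$; the derived subalgebra is $\mathcal{A}^2$. An ideal is nilpotent if it is nilpotent as an algebra. $\mathcal{T}_{\mathbb{K}}$ denotes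 the class of all solvable, non-nilpotent evolution algebras over $\mathbb{K}$ whose derived subalgebra is one-dimensional. For $1\le k\le n$ and scalars $\lambda_1,\dots,\lambda_n\in\mathbb{K}$, not all zero, with $\sum_{j=1}^k\lambda_j=0$, $\mathcal{E}_k(\lambda_1,\dots,\lambda_n)$ denotes the evolution algebra with natural basis $\{e_1,\dots,e_n\}$ and product $e_i^2=\lambda_i(e_1+\dots+e_k)$ for all $i=1,\dots,n$. *)

(* Defs.v *)
(* A (not necessarily associative) finite-dimensional K-algebra is a
   vectType over K together with a bilinear product mul : E -> E -> E; the
   algebra structures of MathComp are all associative. *)
From HB Require Import structures.
From mathcomp Require Import all_boot all_order all_algebra.
From mathcomp Require Import sesquilinear.

Set Implicit Arguments.
Unset Strict Implicit.
Unset Printing Implicit Defensive.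

Import GRing.Theory.
Local Open Scope ring_scope.

Section Algebra.

Variables (K : fieldType) (E : vectType K) (mul : {bilinear E -> E -> E}).

Implicit Types (U V W I N : {vspace E}) (m : nat).

(* By bilinearity, products of basis vectors suffice: see prod_subvP. *)
Definition prod_space U V : {vspace E} :=
  <<[seq mul u v | u <- vbasis U, v <- vbasis V]>>%VS.

Lemma prod_subvP U V W :
  reflect (forall u v, u \in U -> v \in V -> mul u v \in W)
          (prod_space U V <= W)%VS.
Proof.
apply: (iffP idP) => [/span_subvP sUVW u v Uu Vv | sUVW].
  rewrite (coord_vbasis Uu) (coord_vbasis Vv) linear_sumlz.
  apply: memv_suml => i _; rewrite linear_sumr.
  apply: memv_suml => j _; rewrite linearZl_LR linearZr_LR.
  apply/memvZ/memvZ/sUVW/allpairsP.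
  by exists ((vbasis U)`_i, (vbasis V)`_j); rewrite !mem_nth ?size_tuple.
apply/span_subvP => w /allpairsP[[u v] /= [Uu Vv ->]].
by apply: sUVW; apply: vbasis_mem.
Qed.

(* power_seq U m = [:: U^1; ...; U^m]. *)
Fixpoint power_seq U m : seq {vspace E} :=
  if m isn't m'.+1 then [::] else
  let s := power_seq U m' in
  rcons s (if m' == 0%N then U else
           (\sum_(i < m') prod_space (nth 0%VS s i) (nth 0%VS s (m' - i.+1)))%VS).

(* Meaningful for 0 < m only; the defining recursion is power1 and powerS. *)
Definition power U m : {vspace E} := nth 0%VS (power_seq U m) m.-1.

Lemma size_power_seq U m : size (power_seq U m) = m.
Proof. by elim: m => //= m IHm; rewrite size_rcons IHm. Qed.

Lemma nth_power_seq U m i : (i < m)%N -> nth 0%VS (power_seq U m) i = power U i.+1.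
Proof.
elim: m => // m IHm; rewrite ltnS leq_eqVlt => /orP[/eqP-> // | lt_im] /=.
by rewrite nth_rcons size_power_seq lt_im IHm.
Qed.

Lemma power1 U : power U 1 = U. Proof. by []. Qed.

Lemma powerS U m : (0 < m)%N ->
  power U m.+1 =
    (\sum_(1 <= i < m.+1) prod_space (power U i) (power U (m.+1 - i)))%VS.
Proof.
move=> m_gt0; rewrite {1}/power /= nth_rcons size_power_seq ltnn eqxx.
rewrite -[m == 0%N]negbK -lt0n m_gt0 /= big_add1 /= big_mkord.
apply: eq_bigr => i _; rewrite !nth_power_seq //; last by rewrite subnSK ?leq_subr.
by rewrite subnSK // subSS.
Qed.

(* derived_power U m is U^(m), starting from U^(1) = U. *)
Definition derived_power U m : {vspace E} :=
  iter m.-1 (fun V => prod_space V V) U.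

Definition nilpotent U : Prop := exists2 m, (0 < m)%N & power U m = 0%VS.

Definition solvable U : Prop := exists2 m, (0 < m)%N & derived_power U m = 0%VS.

Definition is_ideal I : Prop :=
  forall x y, x \in I -> mul x y \in I /\ mul y x \in I.

Definition nilpotent_ideal I : Prop := is_ideal I /\ nilpotent I.

Definition maximal_nilpotent_ideal N : Prop :=
  nilpotent_ideal N /\
  forall I, nilpotent_ideal I -> (N <= I)%VS -> I = N.

(* N is Nil(E), the unique maximal nilpotent ideal of E. *)
Definition is_Nil N : Prop := unique maximal_nilpotent_ideal N.

Definition natural_basis n (B : n.-tuple E) : Prop :=
  basis_of fullv B /\ forall i j : 'I_n, i != j -> mul B`_i B`_j = 0.

Definition evolution_algebra : Prop :=
  (forall x y, mul x y = mul y x) /\ exists n (B : n.-tuple E), natural_basis B.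

(* Membership in the class T_K; the derived subalgebra is E^2. *)
Definition in_T : Prop :=
  [/\ evolution_algebra, solvable fullv, ~ nilpotent fullv
    & \dim (power fullv 2) = 1%N].

End Algebra.

Definition alg_isomorphic (K : fieldType) (E F : vectType K)
    (mulE : {bilinear E -> E -> E}) (mulF : {bilinear F -> F -> F}) : Prop :=
  exists2 f : 'Hom(E, F),
    bijective f & forall x y, f (mulE x y) = mulF (f x) (f y).

(* The algebras E_k(lambda_1, ..., lambda_n) on K^n. As n >= k >= 1, the
   dimension is written n.+1, and indices are shifted to 0, ..., n: the basis
   vector e_i is std_vec (i-1), and i <= k becomes (i < k)%N. *)
Section Ek.

Variables (K : fieldType) (n k : nat) (lam : 'I_n.+1 -> K).

Definition std_vec (i : 'I_n.+1) : 'rV[K]_n.+1 := delta_mx 0 i.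

(* The bilinear extension of e_i ^ 2 = lambda_i (e_1 + ... + e_k), e_i e_j = 0:
   see Ek_mul_std. *)
Definition Ek_mul (x y : 'rV[K]_n.+1) : 'rV[K]_n.+1 :=
  (\sum_i lam i * x 0 i * y 0 i) *: \sum_(j < n.+1 | (j < k)%N) std_vec j.

Lemma Ek_mul_is_bilinear : bilinear_for *:%R *:%R Ek_mul.
Proof.
split=> u a x y /=; rewrite /Ek_mul scalerA -scalerDl mulr_sumr -big_split /=;
  congr (_ *: _); apply: eq_bigr => i _; rewrite !mxE.
  by rewrite mulrDr mulrDl mulrCA !mulrA.
by rewrite mulrDr mulrCA.
Qed.

HB.instance Definition _ :=
  bilinear_isBilinear.Build K 'rV[K]_n.+1 'rV[K]_n.+1 'rV[K]_n.+1 *:%R *:%R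
    Ek_mul Ek_mul_is_bilinear.

Definition Ek : {bilinear 'rV[K]_n.+1 -> 'rV[K]_n.+1 -> 'rV[K]_n.+1} := Ek_mul.

Lemma Ek_mul_std i j :
  Ek (std_vec i) (std_vec j) =
    if i == j then lam i *: \sum_(l < n.+1 | (l < k)%N) std_vec l else 0.
Proof.
rewrite /= /Ek_mul (bigD1 i) //= big1 => [|l /negbTE ne_li]; last first.
  by rewrite !mxE ne_li mulr0 mul0r.
rewrite !mxE !eqxx mulr1 addr0; case: eqP => _; first by rewrite mulr1.
by rewrite mulr0 scale0r.
Qed.

Definition Ek_params : Prop :=
  [/\ (1 <= k <= n.+1)%N, exists i, lam i != 0
    & \sum_(j < n.+1 | (j < k)%N) lam j = 0].

Definition Ek_reduced : Prop :=
  [/\ Ek_params, (2 <= k)%N & forall i : 'I_n.+1, (i < k)%N -> lam i != 0].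

Definition Ek_nil_span : {vspace 'rV[K]_n.+1} :=
  <<[seq lam i *: std_vec ord0 - lam ord0 *: std_vec i
       | i : 'I_n.+1 <- enum 'I_n.+1 & (0 < i < k)%N]
    ++ [seq std_vec i | i : 'I_n.+1 <- enum 'I_n.+1 & (k <= i)%N]>>%VS.

End Ek.

(* Main.v *)
(* If E^2 is spanned by e, then x y is a multiple of e for all x, y. When E is
   commutative with e^2 = 0, the annihilator N of e is an ideal with N^3 = 0,
   while a nilpotent ideal I contains no x with e x <> 0: such an x would give
   e in I, hence e in every power of I. So N is the largest nilpotent ideal.

   For the normal form, write e = sum_i c_i b_i and b_i^2 = mu_i e in a natural
   basis. The part u of e over the i with c_i mu_i = 0 annihilates E.
   Rescaling the other b_i by c_i and adding u to one of them keeps the basis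
   natural and makes e a sum of basis vectors whose squares are nonzero. *)
From HB Require Import structures.
Require Import Defs.
From mathcomp Require Import all_boot all_order all_algebra.
From mathcomp Require Import perm.
From mathcomp Require Import sesquilinear.

Set Implicit Arguments.
Unset Strict Implicit.
Unset Printing Implicit Defensive.

Import GRing.Theory.
Local Open Scope ring_scope.

(** * Commutative algebras all of whose products lie on one line *)

Section OneDimensionalSquare.

Variables (K : fieldType) (E : vectType K) (mul : {bilinear E -> E -> E}).

Lemma power2 (U : {vspace E}) : power mul U 2 = prod_space mul U U.
Proof. by rewrite powerS // big_nat1 subSS subn0 power1. Qed.

Lemma power3 (U : {vspace E}) :
  power mul U 3 = (prod_space mul U (power mul U 2)
                   + prod_space mul (power mul U 2) U)%VS.
Proof. by rewrite powerS // big_ltn // big_ltn // big_geq // addv0 !power1. Qed.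

Lemma memv_prod (U V : {vspace E}) u v :
  u \in U -> v \in V -> mul u v \in prod_space mul U V.
Proof. by move=> Uu Vv; apply: (prod_subvP _ _ _ _ (subvv _)). Qed.

Hypothesis mulC : forall x y, mul x y = mul y x.

Variable e : E.
Hypothesis mul_line : forall x y, mul x y \in <[e]>%VS.

Lemma ann_line_nilpotent (U : {vspace E}) :
  {in U, forall x, mul e x = 0} -> nilpotent mul U.
Proof.
move=> Ue0; exists 3 => //; apply/eqP; rewrite -subv0 power3 subv_add power2.
have sq_line : (prod_space mul U U <= <[e]>)%VS by apply/prod_subvP.
apply/andP; split; apply/prod_subvP => x y.
  move=> Ux /(subvP sq_line)/vlineP[a ->].
  by rewrite linearZr_LR mulC /= Ue0 // scaler0 mem0v.
by move=> /(subvP sq_line)/vlineP[a ->] Uy; rewrite linearZl_LR /= Ue0 // scaler0 mem0v.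
Qed.

Lemma nilpotent_ideal_ann_line (I : {vspace E}) :
  nilpotent_ideal mul I -> {in I, forall x, mul e x = 0}.
Proof.
move=> [idI [m m_gt0 Im0]] x Ix; apply/eqP/negPn/negP => ex_neq0.
have /vlineP[a ex_eq] := mul_line e x.
have a_neq0 : a != 0 by apply: contraNneq ex_neq0 => a0; rewrite ex_eq a0 scale0r.
have e_eq : e = a^-1 *: mul x e by rewrite mulC ex_eq scalerA mulVf ?scale1r.
(* The summand [i = 1] of the next power suffices: [e] is a multiple of [mul x e] with [x] in
   [I]. *)
have e_pow p : e \in power mul I p.+1.
  elim: p => [|p IHp]; first by rewrite power1 e_eq memvZ //; case: (idI x e Ix).
  rewrite powerS // big_ltn // power1 subSS subn0; apply/(subvP (addvSl _ _)).
  by rewrite e_eq memvZ // memv_prod.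
have := e_pow m.-1; rewrite prednK // Im0 memv0 => /eqP e0.
by rewrite ex_eq e0 scaler0 eqxx in ex_neq0.
Qed.

Lemma unique_maximal_nilpotent_ideal (N : {vspace E}) :
  mul e e = 0 -> (forall x, x \in N <-> mul e x = 0) ->
  unique (maximal_nilpotent_ideal mul) N.
Proof.
move=> ee0 memN.
have nilN : nilpotent_ideal mul N.
  split=> [x y Nx|]; last by apply: ann_line_nilpotent => x /memN.
  (* Since [mul e e = 0], the line of [e], and with it every product, lies in [N]; this makes [N] an
     ideal. *)
  have eN : (<[e]> <= N)%VS by rewrite -memvE; apply/memN.
  by split; apply: (subvP eN).
have maxN I : nilpotent_ideal mul I -> (I <= N)%VS.
  by move=> /nilpotent_ideal_ann_line annI; apply/subvP => x /annI/memN.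
split; first by split=> // I /maxN sIN sNI; apply: subv_anti; rewrite sIN.
by move=> N' [nilN' maxN']; apply: maxN' => //; apply: maxN.
Qed.

End OneDimensionalSquare.

(** * A generator of the derived subalgebra *)

Section ClassT.

Variables (K : fieldType) (E : vectType K) (mul : {bilinear E -> E -> E}).

(** Take [e] spanning the derived subalgebra. If [mul e e] were nonzero, [e] would be a multiple of
    its own square and survive in every derived power, against solvability. If [e] annihilated
    everything, the cube of the algebra would vanish, against non-nilpotency. *)
Lemma in_T_line : in_T mul ->
  exists e : E, [/\ e != 0, forall x y, mul x y \in <[e]>%VS, mul e e = 0
                  & exists x, mul e x != 0].
Proof.
case=> [[mulC _] [m m_gt0 solv] nonnil]; rewrite power2 => dim1.
set D := prod_space mul fullv fullv in dim1 *.
pose e := vpick D.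
have e_neq0 : e != 0 by rewrite vpick0 -dimv_eq0 dim1.
have De : D = <[e]>%VS.
  by apply/esym/eqP; rewrite eqEdim -memvE memv_pick dim1 dim_vline e_neq0.
have mul_line x y : mul x y \in <[e]>%VS by rewrite -De memv_prod ?memvf.
exists e; split=> //.
  have /vlineP[a ee_eq] := mul_line e e.
  have [a0 | a_neq0] := eqVneq a 0; first by rewrite ee_eq a0 scale0r.
  have e_derived p : e \in derived_power mul fullv p.+1.
    elim: p => [|p IHp]; first exact: memvf.
    have -> : e = a^-1 *: mul e e by rewrite ee_eq scalerA mulVf ?scale1r.
    by rewrite memvZ // memv_prod.
  have := e_derived m.-1; rewrite prednK // solv memv0 => /eqP e0.
  by rewrite e0 eqxx in e_neq0.
(* A witness is sought among finitely many basis vectors, which makes the alternative decidable. *)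
have [/existsP [i ei_neq0] | /existsPn ann] :=
  boolP [exists i : 'I_(\dim (fullv : {vspace E})), mul e (vbasis fullv)`_i != 0].
  by exists (vbasis fullv)`_i.
case: nonnil; apply: (ann_line_nilpotent mulC mul_line) => x _.
rewrite (coord_vbasis (memvf x)) linear_sumr big1 // => i _.
by rewrite linearZr_LR /= (eqP (negPn (ann i))) scaler0.
Qed.

End ClassT.

(** List [S] first and its complement after it; the permutation reads off this list. It serves to
    bring the indices that make up the sum [e_1 + ... + e_k] to the front. *)
Lemma exists_perm_initial_segment n (S : {set 'I_n}) :
  exists s : {perm 'I_n}, forall i : 'I_n, (s i \in S) = (i < #|S|)%N.
Proof.
pose t := enum S ++ enum (~: S).
have size_t : size t = n by rewrite size_cat -!cardE cardsC card_ord.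
have uniq_t : uniq t.
  rewrite cat_uniq !enum_uniq andbT /=; apply/hasPn => x.
  by rewrite !mem_enum inE.
have inj_f : injective (fun i : 'I_n => nth i t i).
  move=> i j; rewrite (set_nth_default i) ?size_t // => /eqP.
  by rewrite nth_uniq ?size_t // => /eqP/val_inj.
exists (perm inj_f) => i; rewrite permE nth_cat -cardE.
case: ifPn => [lt_iS | ]; first by rewrite -mem_enum mem_nth // -cardE.
rewrite -leqNgt => le_Si; apply/negbTE; rewrite -in_setC -mem_enum mem_nth //.
by rewrite -cardE -(ltn_add2l #|S|) subnKC // cardsC card_ord.
Qed.

(** * Reduction to the algebras [Ek] *)

Section NormalForm.

Variables (K : fieldType) (E : vectType K) (mul : {bilinear E -> E -> E}).

Lemma natural_basis_perm n (B : n.-tuple E) (s : {perm 'I_n}) :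
  natural_basis mul B -> natural_basis mul [tuple B`_(s i) | i < n].
Proof.
move=> [basB ortB]; split; last first.
  by move=> i j ne_ij; rewrite !nth_mktuple ortB // inj_eq //; apply: perm_inj.
rewrite (perm_basis (Y := B)) //.
apply/tuple_permP; exists s; congr (tval _).
by apply: eq_from_tnth => i; rewrite !tnth_mktuple (tnth_nth 0).
Qed.

Definition coord_row n (G : n.-tuple E) (v : E) : 'rV[K]_n :=
  \row_i coord G i v.

Lemma coord_row_is_linear n (G : n.-tuple E) : linear (coord_row G).
Proof. by move=> a x y; apply/rowP => i; rewrite !mxE linearP. Qed.

HB.instance Definition _ n (G : n.-tuple E) :=
  GRing.isLinear.Build K E 'rV[K]_n *:%R (coord_row G) (coord_row_is_linear G).

(** The isomorphism is the coordinate map of [G], with inverse the linear combination map. *)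
Lemma Ek_isomorphic n k (lam : 'I_n.+1 -> K) (G : n.+1.-tuple E) (e : E) :
  natural_basis mul G -> (forall i : 'I_n.+1, mul G`_i G`_i = lam i *: e) ->
  e = \sum_(i < n.+1 | (i < k)%N) G`_i -> alg_isomorphic mul (Ek k lam).
Proof.
move=> [basG ortG] sqG def_e.
have freeG := basis_free basG.
have expand v : v = \sum_i coord G i v *: G`_i.
  by apply: coord_basis basG (memvf v).
exists (linfun (coord_row G)).
  exists (fun x : 'rV_n.+1 => \sum_i x 0 i *: G`_i) => [v | x]; rewrite lfunE /=.
    by rewrite [RHS]expand; apply: eq_bigr => i _; rewrite mxE.
  by apply/rowP => i; rewrite mxE coord_sum_free.
have coord_row_basis (i : 'I_n.+1) : coord_row G G`_i = std_vec K i.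
  by apply/rowP => j; rewrite !mxE coord_free // eq_sym.
move=> x y; rewrite !lfunE /= /Ek_mul.
have -> : mul x y = (\sum_i lam i * coord G i x * coord G i y) *: e.
  rewrite {1}[x]expand linear_sumlz scaler_suml; apply: eq_bigr => i _.
  rewrite {1}[y]expand linear_sumr (bigD1 i) //= big1 => [|j ne_ji]; last first.
    by rewrite linearZl_LR linearZr_LR /= ortG 1?eq_sym // !scaler0.
  rewrite addr0 linearZl_LR linearZr_LR /= sqG !scalerA.
  by congr (_ *: _); rewrite mulrC mulrA.
rewrite linearZ /= def_e linear_sum; congr (_ *: _).
  by apply: eq_bigr => i _; rewrite !mxE.
by apply: eq_bigr => i _; apply: coord_row_basis.
Qed.

Lemma normal_form n (B : n.-tuple E) (e : E) :
  (forall x y, mul x y = mul y x) -> (forall x y, mul x y \in <[e]>%VS) ->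
  e != 0 -> mul e e = 0 -> (exists x, mul e x != 0) -> natural_basis mul B ->
  exists (m k : nat) (lam : 'I_m.+1 -> K),
    Ek_reduced k lam /\ alg_isomorphic mul (Ek k lam).
Proof.
move=> mulC mul_line e_neq0 ee0 e_act natB0.
have /fin_all_exists[mu0 sqB0] : forall i : 'I_n, exists a, mul B`_i B`_i = a *: e.
  by move=> i; apply/vlineP.
(* As [e b_i = c_i mu_i e], these are the indices with [e b_i] nonzero. *)
pose S := [set i | coord B i e * mu0 i != 0].
have [s sP] := exists_perm_initial_segment S.
pose B' := [tuple B`_(s i) | i < n].
pose mu (i : 'I_n) := mu0 (s i).
pose c (i : 'I_n) : K := coord B (s i) e; pose k := #|S|.
have [basB ortB] : natural_basis mul B' by apply: natural_basis_perm.
have sqB (i : 'I_n) : mul B'`_i B'`_i = mu i *: e by rewrite nth_mktuple sqB0.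
have cmu (i : 'I_n) : (c i * mu i != 0) = (i < k)%N by rewrite -sP inE.
have eE : e = \sum_i c i *: B'`_i.
  rewrite {1}(coord_basis natB0.1 (memvf e)) (reindex_inj (@perm_inj _ s)).
  by apply: eq_bigr => i _; rewrite nth_mktuple.
have le_kn : (k <= n)%N by rewrite -[n]card_ord max_card.
clearbody k c mu B'; clear B mu0 natB0 sqB0 S s sP.
case: n => [|n] in c mu k B' basB ortB sqB cmu eE le_kn *.
  by rewrite eE big_ord0 eqxx in e_neq0.
have mulB (i : 'I_n.+1) v : mul B'`_i v = (coord B' i v * mu i) *: e.
  rewrite {1}(coord_basis basB (memvf v)) linear_sumr (bigD1 i) //=.
  rewrite big1 => [|j ne_ji]; last by rewrite linearZr_LR /= ortB 1?eq_sym ?scaler0.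
  by rewrite addr0 linearZr_LR /= sqB scalerA.
pose u := \sum_(i < n.+1 | ~~ (i < k)%N) c i *: B'`_i.
have annu v : mul u v = 0.
  rewrite linear_sumlz big1 // => i; rewrite -cmu negbK => /eqP cmu0.
  by rewrite linearZl_LR /= mulB scalerA mulrCA cmu0 mulr0 scale0r.
have eEu : e = \sum_(i < n.+1 | (i < k)%N) c i *: B'`_i + u.
  by rewrite {1}eE (bigID (fun i : 'I_n.+1 => i < k)%N).
have k_gt0 : (0 < k)%N.
  rewrite lt0n; apply/eqP => k0; have [x] := e_act.
  by rewrite eEu linearDl /= annu k0 big_pred0 ?addr0 ?linear0l ?eqxx // => i.
pose d (i : 'I_n.+1) := if (i < k)%N then c i else 1.
have d_neq0 i : d i != 0.
  rewrite /d; case: ifP; rewrite ?oner_neq0 // -cmu.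
  by apply: contraNneq => ->; rewrite mul0r.
(* Index 0 is below [k] because [k > 0], so the sum of the first [k] vectors of [G] picks up [u]
   exactly once. *)
pose w (i : 'I_n.+1) : E := if i == ord0 then u else 0.
pose G := [tuple d i *: B'`_i + w i | i < n.+1].
have eG : e = \sum_(i < n.+1 | (i < k)%N) G`_i.
  rewrite [RHS](eq_bigr (fun i => c i *: B'`_i + w i)) => [|i lt_ik]; last first.
    by rewrite nth_mktuple /d lt_ik.
  rewrite big_split /= {1}eEu; congr (_ + _).
  by rewrite -big_mkcondr (big_pred1 ord0) // => i; rewrite andb_idl // => /eqP->.
have annw i v : mul (w i) v = 0 by rewrite /w; case: eqP; rewrite ?linear0l.
have mulG (i j : 'I_n.+1) : mul G`_i G`_j = (d i * d j) *: mul B'`_i B'`_j.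
  rewrite !nth_mktuple linearDl /= annw addr0 linearDr /= [mul _ (w j)]mulC annw.
  by rewrite addr0 linearZl_LR linearZr_LR /= scalerA.
have ortG (i j : 'I_n.+1) : i != j -> mul G`_i G`_j = 0.
  by move=> ne_ij; rewrite mulG ortB ?scaler0.
(* By dimension it is enough that [G] spans each [B'_i]. From index [k] on, [G] and [B'] agree, so
   [u] is in the span and can be subtracted off. *)
have basG : basis_of fullv G.
  rewrite basisEdim size_tuple (size_basis basB) leqnn andbT.
  rewrite -(span_basis basB); apply/span_subvP => x /tnthP[i ->].
  rewrite (tnth_nth 0).
  have memG (j : 'I_n.+1) : G`_j \in <<G>>%VS.
    by rewrite memv_span // mem_nth // size_tuple.
  have uG : u \in <<G>>%VS.
    apply: memv_suml => j le_kj; apply: memvZ; have := memG j.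
    rewrite nth_mktuple /d (negbTE le_kj) scale1r /w ifN ?addr0 //.
    by apply: contraNneq le_kj => ->.
  have wG : w i \in <<G>>%VS by rewrite /w; case: eqP; rewrite ?mem0v.
  have := memG i; rewrite nth_mktuple rpredDr // => dBG.
  by rewrite -[B'`_i](scalerK (d_neq0 i)) memvZ.
pose lam i := d i * d i * mu i.
have sqG (i : 'I_n.+1) : mul G`_i G`_i = lam i *: e by rewrite mulG sqB scalerA.
have lam_neq0 (i : 'I_n.+1) : (i < k)%N -> lam i != 0.
  move=> lt_ik; rewrite /lam -mulrA mulf_neq0 // /d lt_ik.
  by rewrite cmu.
(* Expanding [mul e e = 0] in the orthogonal vectors of [G] gives this sum times [e]. *)
have sum_lam : \sum_(i < n.+1 | (i < k)%N) lam i = 0.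
  have : mul e e = (\sum_(i < n.+1 | (i < k)%N) lam i) *: e.
    rewrite {1 2}eG linear_sumlz scaler_suml; apply: eq_bigr => i lt_ik.
    rewrite linear_sumr (bigD1 i) //= big1 ?addr0 // => j /andP[_ ne_ji].
    by rewrite ortG // eq_sym.
  by rewrite ee0 => /esym/eqP; rewrite scaler_eq0 (negbTE e_neq0) orbF => /eqP.
exists n, k, lam; split; last exact: (Ek_isomorphic (G := G) (e := e)).
split=> //; first by split; [rewrite k_gt0 | exists ord0; apply: lam_neq0 |].
(* For [k = 1] the vanishing sum would be the single nonzero scalar [lam ord0]. *)
rewrite ltn_neqAle k_gt0 andbT; apply/eqP => k1.
move: sum_lam; rewrite (big_pred1 ord0) => [lam0|i]; last by rewrite -k1 ltnS leqn0.
by have := lam_neq0 ord0 k_gt0; rewrite lam0 eqxx.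
Qed.

End NormalForm.

(** * The nilradical of [Ek] *)

Section NilEk.

Variables (K : fieldType) (n k : nat) (lam : 'I_n.+1 -> K).

Let e : 'rV[K]_n.+1 := \sum_(j < n.+1 | (j < k)%N) std_vec K j.

Lemma Ek_mulC x y : Ek k lam x y = Ek k lam y x.
Proof.
by congr (_ *: _); apply: eq_bigr => i _; rewrite -!mulrA [x 0 i * _]mulrC.
Qed.

Lemma sum_std_vec_coord i : e 0 i = (i < k)%:R.
Proof.
rewrite summxE; under eq_bigr => j _ do rewrite mxE eqxx eq_sym /=.
rewrite big_mkcond (bigD1 i) //= eqxx big1 ?addr0 => [|j /negbTE->]; by case: ifP.
Qed.

Lemma Ek_mul_sum_std x :
  Ek k lam e x = (\sum_(j < n.+1 | (j < k)%N) lam j * x 0 j) *: e.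
Proof.
congr (_ *: _); rewrite [RHS]big_mkcond; apply: eq_bigr => i _.
by rewrite sum_std_vec_coord; case: ifP => _; rewrite ?mulr1 // mulr0 mul0r.
Qed.

(** Both sides describe the hyperplane where the sum of [lam j * x 0 j] over [j < k] vanishes. *)
Lemma mem_Ek_nil_span x : (0 < k)%N -> lam ord0 != 0 ->
  x \in Ek_nil_span k lam <-> Ek k lam e x = 0.
Proof.
move=> k_gt0 lam0_neq0; split=> [x_span | ].
  suff /subvP/(_ x x_span) : (Ek_nil_span k lam <= lker (linfun (Ek k lam e)))%VS.
    by rewrite memv_ker lfunE => /eqP.
  have e_std i : Ek k lam e (std_vec K i) = (if (i < k)%N then lam i else 0) *: e.
    rewrite Ek_mul_sum_std; congr (_ *: _); rewrite big_mkcond (bigD1 i) //=.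
    rewrite !mxE !eqxx mulr1 big1 ?addr0 // => j /negbTE ne_ji.
    by rewrite mxE ne_ji mulr0 if_same.
  apply/span_subvP => y; rewrite mem_cat memv_ker lfunE /=.
  case/orP=> /mapP[i]; rewrite mem_filter => /andP[i_k _] ->; last first.
    by rewrite [Ek_mul _ _ _ _]e_std ltnNge i_k scale0r.
  case/andP: i_k => _ lt_ik.
  rewrite linearBr /= !linearZr_LR /= ![Ek_mul _ _ _ _]e_std lt_ik k_gt0.
  by rewrite !scalerA mulrC subrr.
rewrite Ek_mul_sum_std => /eqP; rewrite scaler_eq0.
case/orP=> [/eqP x_sum | /eqP e0]; last first.
  by have /eqP := sum_std_vec_coord ord0; rewrite e0 mxE k_gt0 eq_sym oner_eq0.
suff: lam ord0 *: x \in Ek_nil_span k lam.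
  by move=> /(memvZ (lam ord0)^-1); rewrite scalerA mulVf ?scale1r.
(* For [i < k], [g i] is the negative of a listed generator, or zero at [i = 0]; for [i >= k] it is
   a multiple of [std_vec K i]. In the combination of the [g i] with coefficients [x 0 i], the
   multiples of [std_vec K ord0] cancel by [x_sum], leaving [lam ord0 *: x]. *)
pose g i := lam ord0 *: std_vec K i
            - (if (i < k)%N then lam i else 0) *: std_vec K ord0.
have -> : lam ord0 *: x = \sum_i x 0 i *: g i.
  under [RHS]eq_bigr => i _ do rewrite scalerBr !scalerA.
  rewrite sumrB -scaler_suml [X in _ - X *: _](_ : _ = 0); last first.
    rewrite -[RHS]x_sum [RHS]big_mkcond.
    by apply: eq_bigr => i _; case: ifP => _; rewrite ?mulr0 // mulrC.
  rewrite scale0r subr0 {1}[x]row_sum_delta scaler_sumr.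
  by apply: eq_bigr => i _; rewrite scalerA mulrC.
apply: memv_suml => i _; apply: memvZ; rewrite /g; case: ltnP => [lt_ik | le_ki].
  have [-> | i_neq0] := eqVneq i ord0; first by rewrite subrr mem0v.
  rewrite -opprB memvN memv_span // mem_cat; apply/orP; left.
  by apply/mapP; exists i; rewrite // mem_filter lt_ik mem_enum lt0n i_neq0.
rewrite scale0r subr0 memvZ // memv_span // mem_cat; apply/orP; right.
by apply/mapP; exists i; rewrite // mem_filter le_ki mem_enum.
Qed.

(** The condition that [lam] sums to zero over [j < k] gives [e^2 = 0], so the nilradical is the
    annihilator of [e]. *)
Lemma Ek_reduced_Nil : Ek_reduced k lam -> is_Nil (Ek k lam) (Ek_nil_span k lam).
Proof.
case=> [[_ _ sum_lam] /ltnW k_gt0 lam_neq0].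
apply: (unique_maximal_nilpotent_ideal Ek_mulC (e := e)).
- by move=> x y; apply: memvZ; apply: memv_line.
- rewrite Ek_mul_sum_std (eq_bigr lam) ?sum_lam ?scale0r // => j lt_jk.
  by rewrite sum_std_vec_coord lt_jk mulr1.
- by move=> x; apply: mem_Ek_nil_span; rewrite ?lam_neq0.
Qed.

End NilEk.

Theorem theorem3p4 (K : fieldType) (hK : 2%N \notin [pchar K])
    (E : vectType K) (mul : {bilinear E -> E -> E}) (hE : in_T mul) :
  [/\ exists! N : {vspace E}, maximal_nilpotent_ideal mul N,
      exists (n k : nat) (lam : 'I_n.+1 -> K),
        Ek_reduced k lam /\ alg_isomorphic mul (Ek k lam)
    & forall (n k : nat) (lam : 'I_n.+1 -> K),
        Ek_reduced k lam -> is_Nil (Ek k lam) (Ek_nil_span k lam)].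
Proof.
have [[mulC [n [B natB]]] _ _ _] := hE.
have [e [e_neq0 mul_line ee0 e_act]] := in_T_line hE.
split; last exact: Ek_reduced_Nil.
  (* The nilradical is the kernel of multiplication by [e]. *)
  exists (lker (linfun (mul e))).
  apply: (unique_maximal_nilpotent_ideal mulC mul_line ee0) => x.
  by rewrite memv_ker lfunE; split=> [/eqP | /= ->].
exact: normal_form natB.
Qed.
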